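(* Let $(\mathtt{s},\mathtt{e})$ be a prepare-and-measure scenario on the finite-dimensional Hilbert space $\mathcal{H}$, with reduced space $\mathcal{R}$. (1) If $(\mathtt{s},\mathtt{e})$ admits an operationally noncontextual ontological model with ontic space $\Lambda$, then either $\Lambda$ is an infinite set, or it is discrete (finite) and $\dim(\mathcal{R})\le|\Lambda|$. (2) If $(\mathtt{s},\mathtt{e})$ admits a Riemann integrable operationally noncontextual ontological model, then there exists an operationally noncontextual ontological model for $(\mathtt{s},\mathtt{e})$ with a discrete ontic space $\Lambda_{\min}$ satisfying $$\dim(\mathcal{R})\le|\Lambda_{\min}|\le\dim(\mathcal{R})^2\le\dim(\mathcal{L}(\mathcal{H}))^2.$$
   Context: Scenario. $\mathcal{H}$ is a finite-dimensional complex Hilbert space; $\mathcal{L}(\mathcal{H})$ is the real vector space of Hermitian operators on $\mathcal{H}$ with inner product $\langle a,b\rangle_{\mathcal{L}(\mathcal{H})}=\mathrm{Tr}[ab]$. A state space $\mathtt{s}$ is a nonempty convex set of density matrices on $\mathcal{H}$. An effect space $\mathtt{e}$ is a convex set of effects (Hermitian $E$ with $E\ge 0$ and $\mathbb{1}_{\mathcal{H}}-E\ge 0$) such that $0_{\mathcal{H}},\mathbb{1}_{\mathcal{H}}\in\mathtt{e}$ and for every $E\in\mathtt{e}$ there is a (finite or countable) family $\{E_k\in\mathtt{e}\}_k$ with $E+\sum_kE_k=\mathbb{1}_{\mathcal{H}}$. The pair $(\mathtt{s},\mathtt{e})$ is a prepare-and-measure scenario. $P_{\mathcal{V}}$ denotes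 orthogonal projection onto a subspace $\mathcal{V}\subseteq\mathcal{L}(\mathcal{H})$, and $P_{\mathcal V}(X)=\{P_{\mathcal V}(x):x\in X\}$. The reduced space is $\mathcal{R}:=P_{\mathrm{span}(\mathtt{e})}(\mathrm{span}(\mathtt{s}))\subseteq\mathcal{L}(\mathcal{H})$, a vector space with inherited inner product $\langle\cdot,\cdot\rangle_{\mathcal{R}}$. Model. An operationally noncontextual ontological model for $(\mathtt{s},\mathtt{e})$ with ontic space $\Lambda$ (a set with a fixed positive measure $\mathrm{d}\lambda$; for discrete $\Lambda$ integrals are sums) is a pair of maps $\mu:P_{\mathcal{R}}(\mathtt{s})\times\Lambda\to\mathbb{R}$, $\xi:P_{\mathcal{R}}(\mathtt{e})\times\Lambda\to\mathbb{R}$ such that: (a) $\int_\Lambda\mathrm{d}\lambda\,\mu(\bar\rho,\lambda)=1$ for all $\bar\rho\in P_{\mathcal{R}}(\mathtt{s})$; (b) $\mu\ge0$; (c) for each $\lambda$, $\mu(p\bar\rho_1+(1-p)\bar\rho_2,\lambda)=p\mu(\bar\rho_1,\lambda)+(1-p)\mu(\bar\rho_2,\lambda)$ for all $p\in[0,1]$, $\bar\rho_1,\bar\rho_2\in P_{\mathcal{R}}(\mathtt{s})$; (d) for each $\lambda$, each $K\in\mathbb{N}\cup\{+\infty\}$ and each family $\{E_k\in\mathtt{e}\}_{k=1}^K$ with $\sum_{k=1}^KE_k=\mathbb{1}_{\mathcal{H}}$, $\sum_{k=1}^K\xi(P_{\mathcal{R}}(E_k),\lambda)=1$; (e) $\xi\ge0$;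 (f) for each $\lambda$, $\xi(p\bar E_1+(1-p)\bar E_2,\lambda)=p\xi(\bar E_1,\lambda)+(1-p)\xi(\bar E_2,\lambda)$ for all $p\in[0,1]$, $\bar E_1,\bar E_2\in P_{\mathcal{R}}(\mathtt{e})$; (g) $\langle\bar\rho,\bar E\rangle_{\mathcal{R}}=\int_\Lambda\mathrm{d}\lambda\,\mu(\bar\rho,\lambda)\xi(\bar E,\lambda)$ for all $\bar\rho\in P_{\mathcal{R}}(\mathtt{s})$, $\bar E\in P_{\mathcal{R}}(\mathtt{e})$. The model is Riemann integrable if there exist $\Delta:\mathbb{N}\times\mathbb{N}\to\mathbb{R}_{\ge0}$ and $\lambda^{(\mathrm{dis})}:\mathbb{N}\times\mathbb{N}\to\Lambda$ such that for all $\bar\rho\in P_{\mathcal{R}}(\mathtt{s})$, $\bar E\in P_{\mathcal{R}}(\mathtt{e})$, $$\int_\Lambda\mathrm{d}\lambda\,\mu(\bar\rho,\lambda)\xi(\bar E,\lambda)=\lim_{N\to\infty}\sum_{k=1}^N\Delta_{N,k}\,\mu(\bar\rho,\lambda^{(\mathrm{dis})}_{N,k})\,\xi(\bar E,\lambda^{(\mathrm{dis})}_{N,k}).$$ $|\Lambda|$ is the number of elements of $\Lambda$. *)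

(* Defs.v *)
From HB Require Import structures.
From mathcomp Require Import all_boot all_order all_algebra.
From mathcomp Require Import sesquilinear spectral complex.
From mathcomp Require Import all_classical all_reals all_analysis.
From mathcomp Require Import ring.

Set Implicit Arguments.
Unset Strict Implicit.
Unset Printing Implicit Defensive.

Import Order.TTheory GRing.Theory Num.Theory.
Import numFieldNormedType.Exports.

Local Open Scope classical_set_scope.
Local Open Scope ring_scope.
Local Open Scope sesquilinear_scope.

(* The Hilbert space is C^n with C := R[i]; operators on it are identified with
   their n x n matrices. *)

Section HermitianOperators.
Variables (R : realType) (n : nat).

Record herm : Type := Herm {
  herm_mx :> 'M[R[i]]_n;
  hermP : herm_mx \is hermsymmx }.

HB.instance Definition _ := [isSub for herm_mx].
HB.instance Definition _ := [Choice of herm by <:].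

Lemma hermmxE (A : 'M[R[i]]_n) : (A \is hermsymmx) = (A == A ^t*).
Proof. by rewrite is_hermitianmxE expr0 scale1r. Qed.

Fact hermsymmx_zmod_closed : zmod_closed (hermsymmx : {pred 'M[R[i]]_n}).
Proof.
split=> [|A B]; rewrite ?hermmxE; first by rewrite trmx0 map_mx0.
by move=> /eqP hA /eqP hB; rewrite linearB map_mxB -hA -hB.
Qed.

HB.instance Definition _ :=
  GRing.isZmodClosed.Build 'M[R[i]]_n (hermsymmx : {pred 'M[R[i]]_n})
    hermsymmx_zmod_closed.
HB.instance Definition _ := [SubChoice_isSubZmodule of herm by <:].

Fact herm_scale_subproof (a : R) (A : herm) : ((a%:C)%C *: herm_mx A) \is hermsymmx.
Proof.
have := hermP A; rewrite !hermmxE => /eqP hA; apply/eqP.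
rewrite linearZ /= map_mxZ -hA; congr (_ *: _).
by apply/esym/CrealP; rewrite complex_real.
Qed.

Definition herm_scale a A := Herm (herm_scale_subproof a A).

Fact herm_scalerA a b A : herm_scale a (herm_scale b A) = herm_scale (a * b) A.
Proof. by apply/val_inj; rewrite /= scalerA -rmorphM. Qed.
Fact herm_scale1r : left_id 1 herm_scale.
Proof. by move=> A; apply/val_inj; rewrite /= rmorph1 scale1r. Qed.
Fact herm_scalerDr : right_distributive herm_scale +%R.
Proof. by move=> a A B; apply/val_inj; rewrite /= scalerDr. Qed.
Fact herm_scalerDl A : {morph herm_scale^~ A : a b / a + b}.
Proof. by move=> a b; apply/val_inj; rewrite /= rmorphD scalerDl. Qed.

HB.instance Definition _ := GRing.Zmodule_isLmodule.Build R herm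
  herm_scalerA herm_scale1r herm_scalerDr herm_scalerDl.

Lemma herm_mxZ a (A : herm) : a *: A = (a%:C)%C *: herm_mx A :> 'M[R[i]]_n.
Proof. by []. Qed.

Lemma herm_mxD (A B : herm) : A + B = herm_mx A + B :> 'M[R[i]]_n.
Proof. by []. Qed.

Lemma hermE (A : herm) i j : A i j = ((A j i)^*)%C.
Proof.
by have := hermP A; rewrite hermmxE => /eqP {1}->; rewrite !mxE.
Qed.

(* The real and imaginary parts of a Hermitian matrix are its symmetric,
   resp. antisymmetric, real components, so that A is determined by
   their sum. *)
Definition herm_vec (A : herm) : 'rV[R]_(n * n) :=
  mxvec (\matrix_(i, j) (complex.Re (A i j) + complex.Im (A i j))).

Definition herm_unvec_mx (v : 'rV[R]_(n * n)) : 'M[R[i]]_n :=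
  let B := vec_mx v in
  \matrix_(i, j) Complex ((B i j + B j i) / 2) ((B i j - B j i) / 2).

Fact herm_unvec_subproof v : herm_unvec_mx v \is hermsymmx.
Proof.
rewrite hermmxE; apply/eqP/matrixP => i j; rewrite !mxE.
apply/eqP; rewrite eq_complex /= [X in X / 2 == _]addrC eqxx /=.
by rewrite -mulNr opprB.
Qed.

Definition herm_unvec v := Herm (herm_unvec_subproof v).

Fact herm_vecK : cancel herm_vec herm_unvec.
Proof.
move=> A; apply/val_inj/matrixP => i j.
rewrite /= /herm_unvec_mx /herm_vec mxvecK !mxE (hermE A j i).
case: (A i j) => a b; apply/eqP; rewrite eq_complex /=.
by apply/andP; split; apply/eqP; field.
Qed.

Fact herm_unvecK : cancel herm_unvec herm_vec.
Proof.
move=> v; rewrite -[RHS]vec_mxK /herm_vec; congr mxvec.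
by apply/matrixP => i j; rewrite !mxE /=; field.
Qed.

Fact herm_vec_linear : linear herm_vec.
Proof.
move=> a A B; rewrite /herm_vec -linearP; congr mxvec; apply/matrixP => i j; rewrite !mxE.
case: (A i j) => x y; case: (B i j) => z t /=; ring.
Qed.

Fact herm_vector_axiom : Vector.axiom (n * n) herm.
Proof.
by exists herm_vec; [exact: herm_vec_linear | exists herm_unvec; [exact: herm_vecK | exact: herm_unvecK]].
Qed.

HB.instance Definition _ := Lmodule_hasFinDim.Build R herm herm_vector_axiom.

Lemma dim_herm : \dim {:herm} = (n * n)%N.
Proof. by rewrite dimvf. Qed.

Fact herm1_subproof : (1%:M : 'M[R[i]]_n) \is hermsymmx.
Proof. by rewrite hermmxE trmx1 map_mx1. Qed.
Definition herm1 := Herm herm1_subproof.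

(* Tr[ab] is real for Hermitian a and b. *)
Definition hs (a b : herm) : R := complex.Re (\tr (herm_mx a *m b)).

Lemma hsE (a b : herm) : \tr (herm_mx a *m b) = ((hs a b)%:C)%C.
Proof.
suff : \tr (herm_mx a *m b) = ((\tr (herm_mx a *m b))^*)%C.
  rewrite /hs; case: (\tr _) => x y /eqP; rewrite eq_complex /= eqxx /=.
  by rewrite -addr_eq0 -mulr2n mulrn_eq0 /= => /eqP ->.
rewrite !/mxtrace raddf_sum /=; under [RHS]eq_bigr do rewrite mxE raddf_sum.
rewrite exchange_big; apply: eq_bigr => i _; rewrite mxE.
by apply: eq_bigr => j _ /=; rewrite rmorphM /= -!hermE mulrC.
Qed.

Fact hs_bilinear : bilinear_for *%R *%R hs.
Proof.
split=> [b|a] x y z; rewrite /hs.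
  rewrite herm_mxD herm_mxZ mulmxDl -scalemxAl mxtraceD mxtraceZ.
  by case: (\tr _) (\tr _) => [p q] [r t] /=; ring.
rewrite herm_mxD herm_mxZ mulmxDr -scalemxAr mxtraceD mxtraceZ.
by case: (\tr _) (\tr _) => [p q] [r t] /=; ring.
Qed.

HB.instance Definition _ :=
  bilinear_isBilinear.Build R herm herm R *%R *%R hs hs_bilinear.
Fact hs_sym (a b : herm) : hs a b = (-1) ^+ false * idfun (hs b a).
Proof. by rewrite expr0 mul1r /hs mxtrace_mulC. Qed.
HB.instance Definition _ :=
  isHermitianSesquilinear.Build R herm false idfun hs hs_sym.
Lemma hs_normE (a : herm) :
  hs a a = \sum_i \sum_j (complex.Re (a i j) ^+ 2 + complex.Im (a i j) ^+ 2).
Proof.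
rewrite /hs /mxtrace raddf_sum; apply: eq_bigr => i _; rewrite mxE raddf_sum.
apply: eq_bigr => j _; rewrite (hermE a j i).
by case: (a i j) => x y /=; rewrite mulrN opprK !expr2.
Qed.

Fact hs_gt0 (a : herm) : a != 0 -> 0 < hs a a.
Proof.
have ge0 i j : 0 <= complex.Re (a i j) ^+ 2 + complex.Im (a i j) ^+ 2.
  by rewrite addr_ge0 ?sqr_ge0.
apply: contraNT; rewrite lt_def negb_and negbK hs_normE => /orP[|/negP[]]; last first.
  by apply: sumr_ge0 => i _; apply: sumr_ge0.
rewrite psumr_eq0 => [/allP h|i _]; last exact: sumr_ge0.
apply/eqP/val_inj/matrixP => i j; rewrite mxE.
have /eqP := h i (mem_index_enum _); move/psumr_eq0P => /(_ (fun j _ => ge0 i j)).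
move=> /(_ j isT)/eqP; rewrite paddr_eq0 ?sqr_ge0 // !sqrf_eq0 => /andP[/eqP r0 /eqP i0].
by case: (herm_mx a i j) r0 i0 => x y /= -> ->.
Qed.

HB.instance Definition _ := isDotProduct.Build R herm hs hs_gt0.
End HermitianOperators.

Section Span.
Variables (R : realType) (vT : vectType R).

Definition lin_comb (X : set vT) : set vT :=
  [set v | exists m (c : 'I_m -> R) (x : 'I_m -> vT),
     (forall i, X (x i)) /\ v = \sum_i c i *: x i].

(* Characterized by mem_span_of. *)
Definition span_of (X : set vT) : {vspace vT} :=
  xget 0%VS [set U : {vspace vT} | [set v | v \in U] = lin_comb X].

Lemma lin_comb_span (s : seq vT) (X : set vT) v :
  (forall x, x \in s -> X x) -> v \in (span s) -> lin_comb X v.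
Proof.
move=> sX /(@coord_span _ _ _ (in_tuple s)) ->.
exists (size s), (coord (in_tuple s) ^~ v), (fun i => s`_i); split=> // i.
by apply/sX/mem_nth.
Qed.

Lemma exists_span (X : set vT) : exists U : {vspace vT}, [set v | v \in U] = lin_comb X.
Proof.
pose P k := `[< exists s : seq vT, (forall x, x \in s -> X x) /\ \dim (span s) = k >].
have exP : exists k, P k by exists 0%N; apply/asboolP; exists [::]; rewrite span_nil dimv0.
have ubP k : P k -> (k <= \dim {:vT})%N.
  by move=> /asboolP[s [_ <-]]; exact/dimvS/subvf.
case: (ex_maxnP exP ubP) => k /asboolP[s [sX sk]] kmax.
exists (span s); apply/seteqP; split=> v /=; first exact: lin_comb_span.
move=> [m [c [x [xX ->]]]]; apply: memv_suml => i _; apply: memvZ.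
have : P (\dim (span (x i :: s))).
  apply/asboolP; exists (x i :: s); split=> // y.
  by rewrite inE => /orP[/eqP -> //|/sX].
move=> /kmax; rewrite -sk => le.
have : (span s == span (x i :: s))%VS.
  by rewrite eqEdim le andbT span_cons addvSr.
by move=> /eqP ->; apply: memv_span; rewrite mem_head.
Qed.

Lemma mem_span_of (X : set vT) v : (v \in span_of X) <-> lin_comb X v.
Proof.
have [U hU] := exists_span X.
have <- : [set v | v \in span_of X] = lin_comb X; last by [].
by rewrite /span_of; case: xgetP => [V -> //|/(_ U)].
Qed.

End Span.

Section Projection.
Variables (R : realType) (n : nat).
Local Notation L := (herm R n).
Implicit Types (V : {vspace L}) (x : L).

Definition ocompl V : {vspace L} := @orthov R false idfun L (@hs R n) V.

(* Characterized by orthproj_mem and orthprojP. *)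
Definition orthproj V : 'End(L) := daddv_pi V (ocompl V).

Lemma orthproj_mem V x : orthproj V x \in V.
Proof. exact: memv_pi. Qed.

Lemma cap_orthov V : (V :&: ocompl V = 0)%VS.
Proof.
apply/eqP; rewrite -subv0; apply/subvP => x; rewrite memv_cap memv0.
move=> /andP[xV /mem_orthovP/(_ x xV) /= xx]; apply: contraT => /hs_gt0.
by rewrite xx ltxx.
Qed.

Lemma add_orthov V : (V + ocompl V = fullv)%VS.
Proof.
apply/eqP; rewrite eqEdim subvf /= dimv_disjoint_sum ?cap_orthov //.
pose f (x : L) : 'rV[R]_(\dim V) := \row_i hs x (vbasis V)`_i.
have lf : linear f.
  by move=> a x y; apply/rowP => i; rewrite !mxE (hs_bilinear R n).1.
pose g := linfun (HB.pack_for {linear L -> 'rV[R]_(\dim V)} f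
  (GRing.isLinear.Build _ _ _ _ f lf)).
have gE x : g x = f x by rewrite lfunE.
have <- := limg_ker_dim g fullv; rewrite capfv addnC leq_add //.
  apply: leq_trans (dimvS (subvf _)) _; by rewrite dimvf /dim /= mul1n.
apply/dimvS/subvP => x; rewrite memv_ker gE => /eqP/rowP fx.
apply/mem_orthovP => v /coord_vbasis ->; rewrite linear_sum big1 // => i _.
by rewrite linearZ /=; have := fx i; rewrite !mxE => ->; rewrite mulr0.
Qed.

Lemma orthprojP V x w : w \in V -> hs (x - orthproj V x) w = 0.
Proof.
have xV : x \in (V + ocompl V)%VS by rewrite add_orthov memvf.
rewrite -{1}(daddv_pi_add (cap_orthov V) xV) addrAC subrr add0r.
by have /mem_orthovP := memv_pi (ocompl V) V x; apply.
Qed.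
End Projection.

Section Scenario.
Variables (R : realType) (n : nat).
Local Notation L := (herm R n).
Implicit Types (s e : set L).

Definition psd (A : 'M[R[i]]_n) : Prop :=
  forall v : 'cV[R[i]]_n, 0 <= (v ^t* *m A *m v) 0 0.

Definition density (rho : L) : Prop := psd rho /\ \tr (herm_mx rho) = 1.

Definition effect (E : L) : Prop := psd E /\ psd (herm1 R n - E).

(* Convergence in the norm of the inner product. *)
Definition hs_cvg (u : nat -> L) (x : L) : Prop :=
  (fun N => hs (u N - x) (u N - x)) @ \oo --> (0 : R).

Definition state_space s : Prop :=
  [/\ s !=set0, convex_set (s : set (convex_lmodType L)) & s `<=` density].

Definition effect_space e : Prop :=
  [/\ convex_set (e : set (convex_lmodType L)), e `<=` effect,
      e 0, e (herm1 R n)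
    & forall E, e E ->
      (exists K (F : 'I_K -> L),
         (forall k, e (F k)) /\ E + \sum_k F k = herm1 R n) \/
      (exists F : nat -> L, (forall k, e (F k)) /\
         hs_cvg (fun N => E + \sum_(k < N) F k) (herm1 R n))].

Definition pm_scenario s e : Prop := state_space s /\ effect_space e.

Definition reduced_space s e : {vspace L} :=
  (orthproj (span_of e) @: span_of s)%VS.

(* mu and xi are total in their first argument, but only their values on
   P_R(s), resp. P_R(e), are constrained and used.  Each integral is required
   to exist, since the library's integral is a total function. *)
Record nc_model s e d (Lam : measurableType d)
    (nu : {measure set Lam -> \bar R}) (mu xi : L -> Lam -> R) : Prop := {
  nc_mu_integrable : forall r, (orthproj (reduced_space s e) @` s) r ->
    nu.-integrable setT (EFin \o mu r);
  nc_mu_norm : forall r, (orthproj (reduced_space s e) @` s) r ->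
    \int[nu]_l mu r l = 1;
  nc_mu_ge0 : forall r l, (orthproj (reduced_space s e) @` s) r -> 0 <= mu r l;
  nc_mu_convex : forall (p : R) r1 r2 l, 0 <= p <= 1 ->
    (orthproj (reduced_space s e) @` s) r1 ->
    (orthproj (reduced_space s e) @` s) r2 ->
    mu (p *: r1 + (1 - p) *: r2) l = p * mu r1 l + (1 - p) * mu r2 l;
  nc_xi_norm_fin : forall l K (F : 'I_K -> L),
    (forall k, e (F k)) -> \sum_k F k = herm1 R n ->
    \sum_k xi (orthproj (reduced_space s e) (F k)) l = 1;
  nc_xi_norm_inf : forall l (F : nat -> L),
    (forall k, e (F k)) ->
    hs_cvg (fun N => \sum_(k < N) F k) (herm1 R n) ->
    (fun N => \sum_(k < N) xi (orthproj (reduced_space s e) (F k)) l)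
      @ \oo --> (1 : R);
  nc_xi_ge0 : forall E l, (orthproj (reduced_space s e) @` e) E -> 0 <= xi E l;
  nc_xi_convex : forall (p : R) E1 E2 l, 0 <= p <= 1 ->
    (orthproj (reduced_space s e) @` e) E1 ->
    (orthproj (reduced_space s e) @` e) E2 ->
    xi (p *: E1 + (1 - p) *: E2) l = p * xi E1 l + (1 - p) * xi E2 l;
  nc_integrable : forall r E, (orthproj (reduced_space s e) @` s) r ->
    (orthproj (reduced_space s e) @` e) E ->
    nu.-integrable setT (EFin \o (fun l => mu r l * xi E l));
  nc_born : forall r E, (orthproj (reduced_space s e) @` s) r ->
    (orthproj (reduced_space s e) @` e) E ->
    hs r E = \int[nu]_l (mu r l * xi E l) }.

Definition riemann_integrable s e d (Lam : measurableType d)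
    (nu : {measure set Lam -> \bar R}) (mu xi : L -> Lam -> R) : Prop :=
  exists (Delta : nat -> nat -> R) (lam : nat -> nat -> Lam),
    (forall N k, 0 <= Delta N k) /\
    forall r E, (orthproj (reduced_space s e) @` s) r ->
      (orthproj (reduced_space s e) @` e) E ->
      (fun N => \sum_(1 <= k < N.+1)
         Delta N k * mu r (lam N k) * xi E (lam N k)) @ \oo -->
      \int[nu]_l (mu r l * xi E l).

(* For a discrete ontic space, integrals are sums. *)
Definition discrete_ontic d (Lam : measurableType d)
    (nu : {measure set Lam -> \bar R}) : Prop :=
  (forall A : set Lam, measurable A) /\
  (forall A : set Lam, nu A = counting A).

End Scenario.

(* Main.v *)
(* For (1): reduced states and reduced effects both span the reduced space V, so
   by the Born rule a linear dependency among the functions mu(r_i, .), with r_i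
   a basis of V made of reduced states, would be a dependency among the r_i.
   For (2): mu(., l) and xi(., l) respect linear relations, so a Riemann sum is
   a conic combination of dim(V) x dim(V) matrices, which Caratheodory's theorem
   shortens to dim(V)^2 terms.  Evaluation at the unit effect bounds the
   weighted values of mu, and 0 <= xi <= 1, so the shortened sums converge along
   an ultrafilter and their limit is a discrete model. *)
Require Import Defs.
From HB Require Import structures.
From mathcomp Require Import all_boot all_order all_algebra.
From mathcomp Require Import finmap.
From mathcomp Require Import sesquilinear spectral complex.
From mathcomp Require Import all_classical all_reals all_analysis.
From mathcomp Require Import ring lra.

Set Implicit Arguments.
Unset Strict Implicit.
Unset Printing Implicit Defensive.

Import Order.TTheory GRing.Theory Num.Theory.
Import numFieldNormedType.Exports.

Local Open Scope classical_set_scope.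
Local Open Scope ring_scope.

(** * Spans of sets and bases drawn from them *)

Section Span.
Variables (R : realType) (vT : vectType R).
Implicit Types (X : set vT) (U : {vspace vT}).

Lemma mem_span_of_set X x : X x -> x \in span_of X.
Proof.
move=> Xx; apply/mem_span_of; exists 1, (fun=> 1), (fun=> x).
by rewrite big_ord1 scale1r.
Qed.

Lemma span_of_subP X U : (forall x, X x -> x \in U) <-> (span_of X <= U)%VS.
Proof.
split=> [XU|/subvP XU x /mem_span_of_set/XU //].
apply/subvP => v /mem_span_of[m [c [x [Xx ->]]]].
by apply: memv_suml => i _; apply/memvZ/XU.
Qed.

(** A free family in [X] of maximal size spans, since an element of [X] outside its span would
    extend it. *)
Lemma span_of_basis X : exists b : (\dim (span_of X)).-tuple vT,
  basis_of (span_of X) b /\ forall i, X (tnth b i).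
Proof.
pose P k := `[< exists s : seq vT,
  [/\ forall x, x \in s -> X x, free s & size s = k] >].
have exP : exists k, P k.
  by exists 0%N; apply/asboolP; exists [::]; split=> //; exact: nil_free.
have ubP k : P k -> (k <= \dim {:vT})%N.
  by move=> /asboolP[s [_ /eqP <- <-]]; exact/dimvS/subvf.
case: (ex_maxnP exP ubP) => _ /asboolP[s [sX sfree <-]] smax.
have sb : basis_of (span_of X) s.
  rewrite /basis_of sfree andbT eqEsubv; apply/andP; split.
    by apply/span_subvP => x /sX; exact: mem_span_of_set.
  apply/span_of_subP => x Xx; apply/negPn/negP => xs.
  have /smax : P (size (x :: s)).
    apply/asboolP; exists (x :: s); split=> //; last by rewrite free_cons xs.
    by move=> y; rewrite inE => /orP[/eqP ->|/sX].
  by rewrite /= ltnn.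
have ss : size s == \dim (span_of X).
  by rewrite (size_basis (X := in_tuple s) sb).
by exists (Tuple ss); split=> // i; apply/sX; rewrite mem_tnth.
Qed.

End Span.

Lemma limg_span_of (R : realType) (vT wT : vectType R) (f : 'Hom(vT, wT))
    (X : set vT) :
  (f @: span_of X = span_of (f @` X))%VS.
Proof.
apply/eqP; rewrite eqEsubv; apply/andP; split; last first.
  by apply/span_of_subP => _ [x Xx <-]; apply/memv_img/mem_span_of_set.
apply/subvP => _ /memv_imgP[v /mem_span_of[m [c [x [Xx ->]]]] ->].
rewrite linear_sum; apply: memv_suml => i _; rewrite linearZ /=.
by apply/memvZ/mem_span_of_set; exists (x i).
Qed.

(** * Conic Caratheodory theorem *)

Section Caratheodory.
Variables (R : realFieldType) (vT : vectType R).

Lemma linear_dependence m (v : 'I_m -> vT) : (\dim {:vT} < m)%N ->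
  exists c : 'I_m -> R, \sum_i c i *: v i = 0 /\ exists i, 0 < c i.
Proof.
move=> mgt; pose t := [tuple v i | i < m].
have /freeP : ~~ free t.
  apply/negP => /eqP tfree; move: mgt.
  by rewrite -(size_tuple t) -tfree ltnNge (dimvS (subvf _)).
move=> /existsNP[c /not_implyP[c0 /existsNP[i /eqP ci]]].
have {}c0 : \sum_i c i *: v i = 0.
  by rewrite -[RHS]c0; apply: eq_bigr => j _; rewrite (nth_mktuple v).
(* Negating the relation if necessary yields a positive coefficient, which is what later allows a
   weight to be lowered to zero. *)
have [cgt|cle] := ltP 0 (c i); first by exists c; split=> //; exists i.
exists (fun j => - c j); split.
  by under eq_bigr do rewrite scaleNr; rewrite sumrN c0 oppr0.
by exists i; rewrite oppr_gt0 lt_neqAle ci.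
Qed.

(* A linear dependency among more than dim V generators is subtracted from the
   weights until one of them vanishes. *)
Lemma conic_caratheodory (T : Type) (x0 : T) (v : T -> vT) d m
    (w : 'I_m -> R) (x : 'I_m -> T) :
  (\dim {:vT} <= d)%N -> (forall i, 0 <= w i) ->
  exists (w' : 'I_d -> R) (x' : 'I_d -> T),
    (forall k, 0 <= w' k) /\
    \sum_i w i *: v (x i) = \sum_k w' k *: v (x' k).
Proof.
move=> dimd; elim: m w x => [|m IHm] w x w0.
  exists (fun=> 0), (fun=> x0); split=> //.
  by rewrite big_ord0 big1 // => k _; rewrite scale0r.
have [le|gt] := leqP m.+1 d.
  (* Missing generators are padded with weight 0 at the default point [x0]. *)
  pose sel k := if insub k is Some i then (w i, x i) else (0, x0).
  exists (fun k => (sel (val k)).1), (fun k => (sel (val k)).2); split.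
    by move=> k; rewrite /sel; case: insub.
  pose F k := (sel k).1 *: v (sel k).2.
  transitivity (\sum_(k < m.+1) F k).
    by apply: eq_bigr => i _; rewrite /F /sel valK.
  rewrite (big_ord_widen _ F le) big_mkcond; apply: eq_bigr => k _.
  by case: ifPn => // nk; rewrite /sel insubN //= scale0r.
have [c [c0 [i ci]]] := linear_dependence (v \o x) (leq_ltn_trans dimd gt).
(* The smallest ratio is the largest multiple of the relation that keeps all weights nonnegative; it
   annihilates the weight at [j]. *)
pose j := [arg min_(k < i | 0 < c k) (w k / c k)]%O.
have [cj jmin] : 0 < c j /\ forall k, 0 < c k -> w j / c j <= w k / c k.
  by rewrite /j; case: Order.TotalTheory.arg_minP.
pose t := w j / c j; pose w1 k := w k - t * c k.
have t0 : 0 <= t by rewrite divr_ge0 // ltW.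
have w10 k : 0 <= w1 k.
  rewrite subr_ge0; have [ck|ck] := ltP 0 (c k).
    by rewrite -ler_pdivlMr // jmin.
  by rewrite (le_trans _ (w0 k)) // mulr_ge0_le0.
have [w' [x' [w'0 E]]] := IHm (w1 \o lift j) (x \o lift j) (fun k => w10 _).
exists w', x'; split=> //; rewrite -E.
transitivity (\sum_k w1 k *: v (x k)).
  under [RHS]eq_bigr do rewrite scalerBl -scalerA.
  by rewrite sumrB -scaler_sumr c0 scaler0 subr0.
rewrite (bigD1_ord j) //= [w1 j]/w1 /t divfK ?gt_eqF // subrr scale0r add0r.
by [].
Qed.
End Caratheodory.

(** * Orthogonal projections for the trace inner product *)

Section OrthogonalProjection.
Variables (R : realType) (n : nat).
Local Notation L := (herm R n).
Implicit Types (U V : {vspace L}) (x y w : L).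

Lemma hsC x y : hs x y = hs y x.
Proof. by rewrite hs_sym expr0 mul1r. Qed.

Lemma hs_eq0 x : hs x x = 0 -> x = 0.
Proof.
by move=> xx; apply/eqP/negPn/negP => /hs_gt0; rewrite xx ltxx.
Qed.

Lemma hsZl (a : R) x y : hs (a *: x) y = a * hs x y.
Proof. exact: linearZl_LR. Qed.

Lemma hsZr (a : R) x y : hs x (a *: y) = a * hs x y.
Proof. exact: linearZr_LR. Qed.

Lemma hs_sumZl m (c : 'I_m -> R) (x : 'I_m -> L) y :
  hs (\sum_i c i *: x i) y = \sum_i c i * hs (x i) y.
Proof.
by rewrite linear_sumlz; apply: eq_bigr => i _; exact: hsZl.
Qed.

Lemma hs_orthproj U x w : w \in U -> hs (orthproj U x) w = hs x w.
Proof. by move=> /(orthprojP x)/eqP; rewrite linearBl subr_eq0 => /eqP. Qed.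

Lemma orthproj_uniq U x y :
  y \in U -> (forall w, w \in U -> hs y w = hs x w) -> orthproj U x = y.
Proof.
move=> yU yx; apply/eqP; rewrite -subr_eq0; apply/eqP/hs_eq0.
have dU : orthproj U x - y \in U by rewrite memvB ?orthproj_mem.
by rewrite linearBl /= hs_orthproj // yx // subrr.
Qed.

Lemma orthproj_id U x : x \in U -> orthproj U x = x.
Proof. by move=> xU; apply: orthproj_uniq. Qed.

Lemma limg_orthproj U V : (orthproj U @: V <= U)%VS.
Proof. by apply/subvP => _ /memv_imgP[x _ ->]; exact: orthproj_mem. Qed.

(** Such an [x] is orthogonal to every combination of elements of [X], hence to itself. *)
Lemma span_of_eq0 (X : set L) x : x \in span_of X ->
  (forall y, X y -> hs x y = 0) -> x = 0.
Proof.
move=> /mem_span_of[m [c [y [Xy xE]]]] xX.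
apply: hs_eq0; rewrite {1}xE hs_sumZl big1 // => i _.
by rewrite hsC xX // mulr0.
Qed.

End OrthogonalProjection.

(** * Reduced states and reduced effects *)

Section ReducedSpace.
Variables (R : realType) (n : nat) (s e : set (herm R n)).
Local Notation L := (herm R n).
Local Notation P := (orthproj (reduced_space s e)).

Lemma reduced_spaceS : (reduced_space s e <= span_of e)%VS.
Proof. exact: limg_orthproj. Qed.

(** The projection of a state onto the span of the effects already lies in the reduced space, which
    is contained in that span. *)
Lemma orthproj_state r : s r -> P r = orthproj (span_of e) r.
Proof.
move=> sr; apply: orthproj_uniq => [|w /(subvP reduced_spaceS) we].
  by apply/memv_img/mem_span_of_set.
by rewrite hs_orthproj.
Qed.

Lemma span_of_states : span_of (P @` s) = reduced_space s e.
Proof.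
rewrite [RHS]limg_span_of; congr span_of; apply/seteqP.
split=> [_ [r sr <-]|_ [r sr <-]]; exists r => //; last exact: orthproj_state.
exact/esym/orthproj_state.
Qed.

Lemma span_of_effects : span_of (P @` e) = reduced_space s e.
Proof.
rewrite -limg_span_of; apply/eqP; rewrite eqEsubv limg_orthproj /=.
apply/subvP => x xR; rewrite -(orthproj_id xR).
exact/memv_img/(subvP reduced_spaceS).
Qed.

(** The projection of [E] is absorbed because [P r] lies in the reduced space; that of [r] is then
    absorbed because [E] lies in the span of the effects. *)
Lemma hs_reduced r E : s r -> e E -> hs (P r) (P E) = hs r E.
Proof.
move=> sr eE; rewrite hsC hs_orthproj ?orthproj_mem //.
by rewrite orthproj_state // hsC hs_orthproj //; exact: mem_span_of_set.
Qed.

Lemma hs_reduced_unit r : state_space s -> e (herm1 R n) -> (P @` s) r ->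
  hs r (P (herm1 R n)) = 1.
Proof.
move=> [_ _ sd] e1 [r' sr' <-]; rewrite hs_reduced //.
have [_] := sd _ sr'; rewrite /hs mulmx1 => ->.
by [].
Qed.

End ReducedSpace.

(** * Affine functions on convex sets and linear relations *)

Section AffineFunctions.
Variables (R : realFieldType) (vT : lmodType R) (C : set vT) (f : vT -> R).
Hypothesis C_convex : forall (p : R) x y,
  0 <= p <= 1 -> C x -> C y -> C (p *: x + (1 - p) *: y).
Hypothesis f_affine : forall (p : R) x y, 0 <= p <= 1 -> C x -> C y ->
  f (p *: x + (1 - p) *: y) = p * f x + (1 - p) * f y.

(** By induction: the first weight is split off and the others are divided by their total [t]; if
    [t] is 0, they all vanish. *)
Lemma affine_convex_sum m (c : 'I_m -> R) (x : 'I_m -> vT) :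
  (forall i, 0 <= c i) -> \sum_i c i = 1 -> (forall i, C (x i)) ->
  C (\sum_i c i *: x i) /\ f (\sum_i c i *: x i) = \sum_i c i * f (x i).
Proof.
elim: m c x => [|m IHm] c x c0 c1 Cx.
  by move/eqP: c1; rewrite big_ord0 eq_sym oner_eq0.
pose c' := c \o lift ord0; pose x' := x \o lift ord0.
have c'0 i : 0 <= c' i by exact: c0.
move: c1; rewrite !big_ord_recl -/(\sum_i c' i).
rewrite -/(\sum_i c' i *: x' i) -/(\sum_i c' i * f (x' i)).
set t := \sum_i c' i => c1; have t0 : 0 <= t by exact: sumr_ge0.
have [tz|tn] := eqVneq t 0.
  have c'z i : c' i = 0 by exact: (psumr_eq0P (fun j _ => c'0 j) tz).
  rewrite tz addr0 in c1; rewrite c1 scale1r mul1r !big1 ?addr0 //.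
  - by move=> i _; rewrite c'z mul0r.
  - by move=> i _; rewrite c'z scale0r.
have [||Cy fy] := IHm (fun i => c' i / t) x' _ _ (fun i => Cx _).
- by move=> i; rewrite divr_ge0.
- by rewrite -mulr_suml divff.
have tE : t = 1 - c ord0 by rewrite -c1 addrAC subrr add0r.
have yE : \sum_i c' i *: x' i = (1 - c ord0) *: \sum_i (c' i / t) *: x' i.
  rewrite -tE scaler_sumr; apply: eq_bigr => i _.
  by rewrite scalerA mulrCA divff ?mulr1.
have p01 : 0 <= c ord0 <= 1 by rewrite c0 -subr_ge0 -tE.
rewrite yE; split; first exact: C_convex.
rewrite f_affine // fy -tE mulr_sumr; congr (_ + _); apply: eq_bigr => i _.
by rewrite mulrA [t * _]mulrCA divff ?mulr1.
Qed.

(* The positive and negative parts of the coefficients give two convex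
   combinations of the same point. *)
Lemma affine_relation m (c : 'I_m -> R) (x : 'I_m -> vT) :
  (forall i, C (x i)) -> \sum_i c i = 0 -> \sum_i c i *: x i = 0 ->
  \sum_i c i * f (x i) = 0.
Proof.
move=> Cx c0 cx0.
pose cp i : R := Num.max (c i) 0; pose cm i : R := Num.max (- c i) 0.
have cE i : c i = cp i - cm i.
  rewrite /cp /cm.
  by case: (leP (c i) 0) => ci0; case: (leP (- c i) 0) => ci1; lra.
have cp0 i : 0 <= cp i by rewrite le_max lexx orbT.
have cm0 i : 0 <= cm i by rewrite le_max lexx orbT.
have sumE : \sum_i cp i = \sum_i cm i.
  apply/eqP; rewrite -subr_eq0 -sumrB -[X in _ == X]c0; apply/eqP.
  by apply: eq_bigr => i _; rewrite cE.
have sumxE : \sum_i cp i *: x i = \sum_i cm i *: x i.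
  apply/eqP; rewrite -subr_eq0 -sumrB -[X in _ == X]cx0; apply/eqP.
  by apply: eq_bigr => i _; rewrite cE scalerBl.
(* If the negative part has total mass 0, all coefficients vanish; otherwise both parts are
   normalized by their common mass. *)
have [tz|tn] := eqVneq (\sum_i cm i) 0.
  have cpz := psumr_eq0P (fun i _ => cp0 i) (etrans sumE tz).
  have cmz := psumr_eq0P (fun i _ => cm0 i) tz.
  by apply: big1 => i _; rewrite cE cpz // cmz // subrr mul0r.
set t := \sum_i cm i in sumE tn; have t0 : 0 <= t by exact: sumr_ge0.
have div1 (a : 'I_m -> R) : \sum_i a i = t -> \sum_i a i / t = 1.
  by rewrite -mulr_suml => ->; rewrite divff.
have divx (a : 'I_m -> R) :
    \sum_i (a i / t) *: x i = t^-1 *: \sum_i a i *: x i.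
  by rewrite scaler_sumr; apply: eq_bigr => i _; rewrite scalerA mulrC.
have [_ fp] :=
  affine_convex_sum (fun i => divr_ge0 (cp0 i) t0) (div1 _ sumE) Cx.
have [_ fm] :=
  affine_convex_sum (fun i => divr_ge0 (cm0 i) t0) (div1 cm erefl) Cx.
have /eqP : \sum_i cp i / t * f (x i) = \sum_i cm i / t * f (x i).
  by rewrite -fp -fm !divx sumxE.
rewrite -subr_eq0 -sumrB => /eqP E; apply: (mulfI (invr_neq0 tn)).
rewrite mulr0 mulr_sumr -[RHS]E; apply: eq_bigr => i _.
by rewrite cE; ring.
Qed.

(** Adjoining the point 0 with weight [- \sum_j c j] makes the coefficients sum to zero and, as
    [f 0 = 0], changes neither of the other sums. *)
Lemma affine0_relation m (c : 'I_m -> R) (x : 'I_m -> vT) : C 0 -> f 0 = 0 ->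
  (forall i, C (x i)) -> \sum_i c i *: x i = 0 -> \sum_i c i * f (x i) = 0.
Proof.
move=> C0 f0 Cx cx0.
pose c' i := if unlift ord0 i is Some j then c j else - \sum_j c j.
pose x' i := if unlift ord0 i is Some j then x j else 0.
have c'0 : c' ord0 = - \sum_j c j by rewrite /c' unlift_none.
have x'0 : x' ord0 = 0 by rewrite /x' unlift_none.
have := @affine_relation m.+1 c' x'.
rewrite !big_ord_recl c'0 x'0 scaler0 f0 mulr0 !add0r.
have -> : \sum_i c' (lift ord0 i) = \sum_i c i.
  by apply: eq_bigr => i _; rewrite /c' liftK.
have -> : \sum_i c' (lift ord0 i) *: x' (lift ord0 i) = \sum_i c i *: x i.
  by apply: eq_bigr => i _; rewrite /c' /x' liftK.
have -> : \sum_i c' (lift ord0 i) * f (x' (lift ord0 i)) = \sum_i c i * f (x i).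
  by apply: eq_bigr => i _; rewrite /c' /x' liftK.
by apply=> //; [move=> i; rewrite /x'; case: unliftP | rewrite addNr].
Qed.

End AffineFunctions.

(** The hypothesis is applied to the relation formed by the coordinates of [x] on the basis and the
    coefficient -1 on [x] itself. *)
Lemma coord_expansion (R : realType) (vT : vectType R) (C : set vT)
    (f : vT -> R) (b : (\dim (span_of C)).-tuple vT) x :
  (forall m (c : 'I_m -> R) (y : 'I_m -> vT), (forall i, C (y i)) ->
     \sum_i c i *: y i = 0 -> \sum_i c i * f (y i) = 0) ->
  basis_of (span_of C) b -> (forall i, C (tnth b i)) -> C x ->
  f x = \sum_i coord b i x * f (tnth b i).
Proof.
move=> flin bb Cb Cx.
pose c' i := if unlift ord0 i is Some j then coord b j x else -1.
pose y i := if unlift ord0 i is Some j then tnth b j else x.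
have c'0 : c' ord0 = -1 by rewrite /c' unlift_none.
have y0 : y ord0 = x by rewrite /y unlift_none.
have := flin _ c' y; rewrite !big_ord_recl c'0 y0.
rewrite scaleN1r mulN1r => h; apply/esym/eqP; rewrite -subr_eq0 addrC.
apply/eqP; rewrite -[RHS]h.
- by congr (_ + _); apply: eq_bigr => i _; rewrite /c' /y liftK.
- by move=> i; rewrite /y; case: unliftP.
rewrite [in LHS](coord_basis bb (mem_span_of_set Cx)) addrC; apply/eqP.
rewrite subr_eq0; apply/eqP; apply: eq_bigr => i _.
by rewrite /c' /y liftK (tnth_nth 0).
Qed.

(** * Limits along ultrafilters *)

Section UltrafilterLimits.
Variables (R : realType) (T : Type) (U : set_system T).
Context {UU : UltraFilter U}.

(** The image of an ultrafilter is an ultrafilter, and here it contains the compact segment from [a]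
    to [b]. *)
Lemma ultra_cvg_bounded (u : T -> R) (a b : R) :
  (\forall x \near U, a <= u x <= b) -> cvg (u @ U).
Proof.
move=> uab; have uU : UltraFilter (u @ U).
  split=> [|G GG UG]; first exact: fmap_proper_filter.
  apply/seteqP; split=> A; last exact: UG.
  move=> GA; have [//|UnA] := in_ultra_setVsetC (u @^-1` A) UU.
  have GnA : G (~` A) by exact: UG.
  by have [x []] := filter_ex (filterI GA GnA).
have := @segment_compact R a b; rewrite compact_ultra => /(_ _ uU)[].
  by near=> x; rewrite /= in_itv /=; near: x.
by move=> l [_ ul]; apply/cvg_ex; exists l.
Unshelve. all: by end_near. Qed.

End UltrafilterLimits.

Lemma cvg_sumr (R : realType) (T : Type) (F : set_system T) (FF : Filter F)
    m (u : 'I_m -> T -> R) (l : 'I_m -> R) :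
  (forall i, u i @ F --> l i) ->
  (fun x => \sum_i u i x) @ F --> \sum_i l i.
Proof.
elim: m u l => [|m IHm] u l ul.
  by rewrite big_ord0; under eq_fun do rewrite big_ord0; exact: cvg_cst.
rewrite big_ord_recl; under eq_fun do rewrite big_ord_recl.
by apply: cvgD; [exact: ul|exact: IHm].
Qed.

(** * Finite ordinals as discrete measurable spaces *)

Section OrdinalCounting.
Variable n : nat.

HB.instance Definition _ := isPointed.Build 'I_n.+1 ord0.
HB.instance Definition _ := @isMeasurable.Build default_measure_display
  'I_n.+1 discrete_measurable discrete_measurable0
  discrete_measurableC discrete_measurableU.

Variable R : realType.
Implicit Types (f : 'I_n.+1 -> R).

(** The whole space is a disjoint union of singletons, each of counting measure 1. *)
Lemma integral_counting_ord f :
  (\int[@counting 'I_n.+1 R]_x (f x)%:E = (\sum_k f k)%:E)%E.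
Proof.
have TE : [set: 'I_n.+1] = \big[setU/set0]_(k <- index_enum 'I_n.+1) [set k].
  apply/seteqP; split=> // k _; rewrite -bigcup_seq; exists k => //=.
  exact: mem_index_enum.
rewrite [in LHS]TE integral_bigsetU_EFin //=.
- rewrite -sumEFin; apply: eq_bigr => k _.
  rewrite (eq_integral (cst (f k)%:E)); last by move=> x /[!inE] ->.
  by rewrite integral_cst //= /counting asboolT // fset_set1 cardfs1 mule1.
- exact: index_enum_uniq.
- apply/trivIsetP => i j _ _ ij; apply/disjoints_subset.
  by move=> x -> /= /eqP; rewrite (negbTE ij).
Qed.

Lemma integrable_counting_ord f :
  (@counting 'I_n.+1 R).-integrable setT (EFin \o f).
Proof.
apply/integrableP; split=> //.
by rewrite (integral_counting_ord (fun k => `|f k|)) ltry.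
Qed.

Lemma Rintegral_counting_ord f :
  \int[@counting 'I_n.+1 R]_x f x = \sum_k f k.
Proof. by rewrite /Rintegral integral_counting_ord. Qed.

Lemma card_setT_ord : #|` fset_set [set: 'I_n.+1]| = n.+1.
Proof. by apply/card_fset_set; rewrite card_eq_sym; exact: card_II. Qed.

End OrdinalCounting.

(** * Riesz representation and continuity of linear functionals *)

Section Functionals.
Variables (R : realType) (n : nat).
Local Notation L := (herm R n).

(** The squared norm of [x - a *: y] is nonnegative, in particular at its minimizer
    [a = hs x y / hs y y]. *)
Lemma hs_CauchySchwarz (x y : L) : hs x y ^+ 2 <= hs x x * hs y y.
Proof.
have [->|y0] := eqVneq y 0; first by rewrite !linear0r expr0n.
have yy := hs_gt0 y0; pose z a := x - a *: y.
have zE a : hs (z a) (z a) = hs x x - a * hs x y - a * (hs x y - a * hs y y).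
  rewrite /z linearBl /= !linearBr /=.
  by rewrite !hsZr !hsZl (hsC y x); ring.
have : 0 <= hs (z (hs x y / hs y y)) (z (hs x y / hs y y)).
  have [->|z0] := eqVneq (z (hs x y / hs y y)) 0; first by rewrite linear0r.
  exact/ltW/hs_gt0.
rewrite zE -(ler_pM2r yy) mul0r => h.
rewrite -subr_ge0 (le_trans h) // le_eqVlt; apply/orP; left; apply/eqP.
by field; rewrite gt_eqF.
Qed.

(** For nonzero [g], the representing vector is a multiple of a vector [u] orthogonal to the kernel:
    subtracting a suitable multiple of [u] from [x] lands in the kernel. *)
Lemma hs_riesz (g : {scalar L}) : exists t, forall x, g x = hs x t.
Proof.
have [g0|/existsNP[z /eqP gz]] := pselect (forall x, g x = 0).
  by exists 0 => x; rewrite g0 linear0r.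
pose K := lker (linfun (g : L -> R^o)).
have memK x : (x \in K) = (g x == 0) by rewrite memv_ker lfunE.
pose u := z - orthproj K z.
have gu : g u != 0.
  have := orthproj_mem K z; rewrite memK => /eqP gp.
  by rewrite linearB /= gp subr0.
have uu : hs u u != 0.
  by apply: contra_neq gu => /hs_eq0 ->; rewrite linear0.
exists ((g u / hs u u) *: u) => x.
have : x - (g x / g u) *: u \in K.
  by rewrite memK linearB linearZ /= mulrVK ?unitfE // subrr.
move=> /(orthprojP z); rewrite -/u linearBr /= hsZr hsC => /eqP.
rewrite subr_eq0 hsZr => /eqP ->.
by field; rewrite gu.
Qed.

Lemma hs_cvg_scalar (g : {scalar L}) (u : nat -> L) x :
  hs_cvg u x -> (fun N => g (u N)) @ \oo --> g x.
Proof.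
move=> ux; have [t gE] := hs_riesz g.
have -> : (fun N => g (u N)) = (fun N => hs (u N - x) t + g x).
  by apply/funext => N; rewrite !gE linearBl /= subrK.
rewrite -[X in _ --> X]add0r; apply: cvgD; last exact: cvg_cst.
apply: norm_cvg0; apply: (@squeeze_cvgr _ _ _ _ (fun=> 0)
  (fun N => Num.sqrt (hs (u N - x) (u N - x) * hs t t))
  (fun N => `|hs (u N - x) t|)).
- near=> N; rewrite normr_ge0 /= -sqrtr_sqr ler_wsqrtr //.
  exact: hs_CauchySchwarz.
- exact: cvg_cst.
rewrite -(sqrtr0 R); apply: continuous_cvg; first exact: sqrt_continuous.
by rewrite -[X in _ --> X](mul0r (hs t t)); apply: cvgM => //; exact: cvg_cst.
Unshelve. all: by end_near. Qed.

End Functionals.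

Lemma Rintegral_sumr d (T : measurableType d) (R : realType)
    (nu : {measure set T -> \bar R}) m (f : 'I_m -> T -> R) :
  (forall i, nu.-integrable setT (EFin \o f i)) ->
  \int[nu]_x (\sum_i f i x) = \sum_i \int[nu]_x f i x.
Proof.
move=> fint; rewrite /Rintegral; under eq_integral do rewrite -sumEFin.
rewrite integral_sum // sum_fine // => i _.
by apply: integrable_fin_num => //; exact: fint.
Qed.

(** * Linear relations among reduced states and reduced effects *)

Section ScenarioFacts.
Variables (R : realType) (n : nat) (s e : set (herm R n)).
Hypothesis hse : pm_scenario s e.
Local Notation L := (herm R n).
Local Notation P := (orthproj (reduced_space s e)).
Local Notation PS := (P @` s).
Local Notation PE := (P @` e).
Implicit Types (f : L -> R) (r E : L).

Lemma convex_limg (X : set L) (h : 'End(L)) (p : R) x y :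
  convex_set (X : set (convex_lmodType L)) -> 0 <= p <= 1 ->
  (h @` X) x -> (h @` X) y -> (h @` X) (p *: x + (1 - p) *: y).
Proof.
move=> Xconv /andP[p0 p1] [x' Xx' <-] [y' Xy' <-].
exists (p *: x' + (1 - p) *: y'); last by rewrite linearD !linearZ.
have := Xconv x' y' (Itv01 p0 p1) (mem_set Xx') (mem_set Xy').
by rewrite inE.
Qed.

Lemma states_convex (p : R) x y :
  0 <= p <= 1 -> PS x -> PS y -> PS (p *: x + (1 - p) *: y).
Proof. by apply: convex_limg; case: hse => -[]. Qed.

Lemma effects_convex (p : R) x y :
  0 <= p <= 1 -> PE x -> PE y -> PE (p *: x + (1 - p) *: y).
Proof. by apply: convex_limg; case: hse => _ []. Qed.

Lemma effect_unit : e (herm1 R n). Proof. by case: hse => _ []. Qed.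

Lemma reduced_unit : PE (P (herm1 R n)).
Proof. by exists (herm1 R n) => //; exact: effect_unit. Qed.

Lemma reduced0 : PE 0.
Proof. by exists 0; [case: hse => _ [] | rewrite linear0]. Qed.

Lemma hs_state_unit r : PS r -> hs r (P (herm1 R n)) = 1.
Proof. by apply: hs_reduced_unit; [case: hse | exact: effect_unit]. Qed.

(** A reduced state pairs to 1 with the reduced unit effect, so it is nonzero. *)
Lemma dim_reduced_gt0 : (0 < \dim (reduced_space s e))%N.
Proof.
have [[r sr] _ _] := hse.1; have PSr : PS (P r) by exists r.
rewrite lt0n dimv_eq0 -span_of_states; apply/eqP => z.
have := mem_span_of_set PSr; rewrite z memv0 => /eqP r0.
by have /eqP := hs_state_unit PSr; rewrite r0 linear0l eq_sym oner_eq0.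
Qed.

(** Pairing the relation with the reduced unit effect shows that the coefficients sum to zero, so
    affinity of [f] suffices. *)
Lemma state_relation f :
  (forall (p : R) x y, 0 <= p <= 1 -> PS x -> PS y ->
     f (p *: x + (1 - p) *: y) = p * f x + (1 - p) * f y) ->
  forall m (c : 'I_m -> R) (r : 'I_m -> L), (forall i, PS (r i)) ->
  \sum_i c i *: r i = 0 -> \sum_i c i * f (r i) = 0.
Proof.
move=> faff m c r PSr cr0; apply: (affine_relation states_convex faff) => //.
have /eqP := congr1 (fun x => hs x (P (herm1 R n))) cr0.
rewrite hs_sumZl linear0l => /eqP E; rewrite -[RHS]E.
by apply: eq_bigr => i _; rewrite hs_state_unit ?mulr1.
Qed.

Lemma effect_relation f :
  (forall (p : R) x y, 0 <= p <= 1 -> PE x -> PE y ->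
     f (p *: x + (1 - p) *: y) = p * f x + (1 - p) * f y) -> f 0 = 0 ->
  forall m (c : 'I_m -> R) (E : 'I_m -> L), (forall i, PE (E i)) ->
  \sum_i c i *: E i = 0 -> \sum_i c i * f (E i) = 0.
Proof.
move=> faff f0 m c E PEE.
by apply: (affine0_relation effects_convex faff _ f0 PEE); exact: reduced0.
Qed.

(* [f] extends to a linear, hence continuous, functional. *)
Lemma effect_affine_cvg f (F : nat -> L) :
  (forall (p : R) x y, 0 <= p <= 1 -> PE x -> PE y ->
     f (p *: x + (1 - p) *: y) = p * f x + (1 - p) * f y) -> f 0 = 0 ->
  (forall k, e (F k)) -> hs_cvg (fun N => \sum_(k < N) F k) (herm1 R n) ->
  (fun N => \sum_(k < N) f (P (F k))) @ \oo --> f (P (herm1 R n)).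
Proof.
move=> faff f0 eF Fcvg; have [b [bb Pb]] := span_of_basis PE.
pose g0 (x : L) : R := \sum_i coord b i (P x) * f (tnth b i).
have lg : linear_for *%R g0.
  move=> a x y; rewrite /g0 mulr_sumr -big_split; apply: eq_bigr => i _ /=.
  by rewrite linearP linearP /= mulrDl mulrA.
pose g := HB.pack_for {scalar L} g0 (GRing.isLinear.Build _ _ _ _ g0 lg).
have gE E : e E -> g E = f (P E).
  move=> eE; have PEE : PE (P E) by exists E.
  by rewrite (coord_expansion (effect_relation faff f0) bb Pb PEE).
rewrite -(gE _ effect_unit).
have -> : (fun N => \sum_(k < N) f (P (F k))) =
    (fun N => g (\sum_(k < N) F k)).
  apply/funext => N; rewrite linear_sum; apply: eq_bigr => k _.
  by rewrite gE.
exact: hs_cvg_scalar.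
Qed.

(** * From an arbitrary model to bounds and finite models *)

Section Model.
Variables (d : measure_display) (Lam : measurableType d).
Variables (nu : {measure set Lam -> \bar R}) (mu xi : L -> Lam -> R).
Hypothesis M : nc_model s e nu mu xi.

Lemma model_xi_unit l : xi (P (herm1 R n)) l = 1.
Proof.
have := nc_xi_norm_fin M l (F := fun _ : 'I_1 => herm1 R n) (fun=> effect_unit).
by rewrite !big_ord1; exact.
Qed.

(** Normalization is applied to the two-outcome measurement made of the unit and the zero effect. *)
Lemma model_xi0 l : xi 0 l = 0.
Proof.
have e0 : e 0 by case: hse => _ [].
pose F (k : 'I_2) : L := if k == ord0 then herm1 R n else 0.
have eF k : e (F k) by rewrite /F; case: ifP => // _; exact: effect_unit.
have := nc_xi_norm_fin M l eF.
rewrite !big_ord_recl !big_ord0 /F /= linear0 !addr0 model_xi_unit.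
by move=> /(_ erefl) h; apply: (addrI 1); rewrite addr0.
Qed.

(** The effect is the first outcome of some finite or countable measurement, whose other outcomes
    have nonnegative values. *)
Lemma model_xi_le1 E l : PE E -> xi E l <= 1.
Proof.
move=> [E' eE' <-]; have [_ _ _ _ eC] := hse.2.
case: (eC _ eE') => [[K [F [eF FE]]]|[F [eF FE]]].
  pose G (k : 'I_K.+1) : L := if unlift ord0 k is Some j then F j else E'.
  have eG k : e (G k) by rewrite /G; case: unlift.
  have := nc_xi_norm_fin M l eG; rewrite !big_ord_recl {1 3}/G unlift_none.
  under eq_bigr do rewrite /G liftK.
  move=> /(_ FE) <-; rewrite lerDl sumr_ge0 // => k _.
  by apply: (nc_xi_ge0 M); exists (G (lift ord0 k)).
pose G k : L := if k is j.+1 then F j else E'.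
have eG k : e (G k) by case: k.
have Gcvg : hs_cvg (fun N => \sum_(k < N) G k) (herm1 R n).
  rewrite /hs_cvg -cvg_shiftS /=.
  by under eq_fun do rewrite big_ord_recl.
have := nc_xi_norm_inf M l eG Gcvg; rewrite -cvg_shiftS => h.
apply: (cvgr_to_ge h); apply: nearW => N /=.
rewrite big_ord_recl lerDl sumr_ge0 // => k _.
by apply: (nc_xi_ge0 M); exists (G (lift ord0 k)).
Qed.

Lemma model_dim_le_card : finite_set [set: Lam] ->
  (\dim (reduced_space s e) <= #|` fset_set [set: Lam]|)%N.
Proof.
move=> finL; rewrite leqNgt -span_of_states; apply/negP => lt.
have [b [bb Pb]] := span_of_basis PS.
set X := fset_set _ in lt.
(* Listing the values of [mu] at all ontic points gives more vectors than the dimension of their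
   space. *)
pose v i : 'rV[R]_#|` X| := \row_j mu (tnth b i) (nth point X j).
have [|c [cv [i0]]] := @linear_dependence _ _ _ v.
  by rewrite dimvf /dim /= mul1n.
have cmu l : \sum_i c i * mu (tnth b i) l = 0.
  have lX : l \in X by rewrite in_fset_set // inE.
  have lt_l : (index l X < #|` X|)%N by rewrite index_mem.
  have := congr1 (fun w : 'rV_ _ => w 0 (Ordinal lt_l)) cv.
  rewrite summxE mxE => E; rewrite -[RHS]E; apply: eq_bigr => i _.
  by rewrite !mxE nth_index.
(* The combination lies in the reduced space, which the reduced effects span, so vanishing against
   each of them is enough; the Born rule turns this into the pointwise relation [cmu]. *)
have x0 : \sum_i c i *: tnth b i = 0.
  apply: (@span_of_eq0 _ _ PE) => [|E PEE].
    apply: memv_suml => i _; apply: memvZ.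
    have := mem_span_of_set (Pb i); move: (tnth b i) => y.
    by rewrite span_of_states span_of_effects.
  pose h i l := c i * (mu (tnth b i) l * xi E l).
  have muxi i :
      nu.-integrable setT (EFin \o (fun l => mu (tnth b i) l * xi E l)).
    exact: (nc_integrable M).
  have hE i : \int[nu]_l h i l = c i * hs (tnth b i) E.
    by rewrite (nc_born M) // RintegralZl.
  rewrite hs_sumZl; under eq_bigr do rewrite -hE.
  rewrite -Rintegral_sumr; last first.
    by move=> i; apply: integrableZl (muxi i).
  rewrite /Rintegral integral0_eq // => l _; congr EFin.
  rewrite /h; under eq_bigr do rewrite mulrA.
  by rewrite -mulr_suml cmu mul0r.
have /freeP/(_ c) -> := basis_free bb; first by rewrite ltxx.
rewrite -[RHS]x0.
by apply: eq_bigr => i _; rewrite (tnth_nth 0).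
Qed.

Lemma model_caratheodory (K m : nat) (l0 : Lam) (w : 'I_m -> R)
    (x : 'I_m -> Lam) :
  (\dim (reduced_space s e) ^ 2 <= K)%N -> (forall i, 0 <= w i) ->
  exists (w' : 'I_K -> R) (x' : 'I_K -> Lam), (forall k, 0 <= w' k) /\
    forall r E, PS r -> PE E -> \sum_i w i * mu r (x i) * xi E (x i) =
                  \sum_k w' k * mu r (x' k) * xi E (x' k).
Proof.
move=> leK w0.
have [b [bb Pb]] := span_of_basis PS; have [c [cb Pc]] := span_of_basis PE.
pose v l := \matrix_(i, j) (mu (tnth b i) l * xi (tnth c j) l).
have [|w' [x' [w'0 E]]] := @conic_caratheodory _ _ _ l0 v K _ _ x _ w0.
  rewrite dimvf /dim /= span_of_states span_of_effects; exact: leK.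
exists w', x'; split=> // r F PSr PEF.
pose a := \row_i coord b i r; pose a' := \col_j coord c j F.
(* The product of the two functions is a bilinear form in the coordinates of [r] and [F] with matrix
   [v l], so an identity between conic combinations of these matrices gives all the sums at once. *)
have vE l : mu r l * xi F l = (a *m v l *m a') 0 0.
  have mul := state_relation (fun p r1 r2 => nc_mu_convex M l).
  have xil := effect_relation (fun p E1 E2 => nc_xi_convex M l) (model_xi0 l).
  have /= -> := coord_expansion (f := mu^~ l) mul bb Pb PSr.
  have /= -> := coord_expansion (f := xi^~ l) xil cb Pc PEF.
  rewrite mxE mulr_sumr; apply: eq_bigr => j _; rewrite !mxE !mulr_suml.
  by apply: eq_bigr => i _; rewrite !mxE; ring.
have sumE q (u : 'I_q -> R) (y : 'I_q -> Lam) :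
    \sum_i u i * mu r (y i) * xi F (y i) =
    (a *m (\sum_i u i *: v (y i)) *m a') 0 0.
  rewrite mulmx_sumr mulmx_suml summxE; apply: eq_bigr => i _.
  by rewrite -mulrA vE -scalemxAr -scalemxAl [RHS]mxE.
by rewrite !sumE E.
Qed.

Lemma finite_model K : (\dim (reduced_space s e) ^ 2 <= K.+1)%N ->
  riemann_integrable s e nu mu xi ->
  exists mu' xi' : L -> 'I_K.+1 -> R,
    nc_model s e (@counting 'I_K.+1 R) mu' xi'.
Proof.
move=> leK [Delta [lam [Delta0 Rcvg]]].
have /choice[wx wxP] N : exists wx : ('I_K.+1 -> R) * ('I_K.+1 -> Lam),
    (forall k, 0 <= wx.1 k) /\ forall r E, PS r -> PE E ->
      \sum_(1 <= k < N.+1) Delta N k * mu r (lam N k) * xi E (lam N k) =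
      \sum_k wx.1 k * mu r (wx.2 k) * xi E (wx.2 k).
  (* Riemann sums are indexed from 1, ordinals from 0, hence the shift [i.+1]. *)
  have [w' [x' [w'0 E]]] := model_caratheodory (lam 0 0)
    (w := fun i : 'I_N => Delta N i.+1) (fun i => lam N i.+1) leK
    (fun i => Delta0 N _).
  exists (w', x'); split=> // r F PSr PEF.
  by rewrite -E // big_add1 big_mkord.
(* The weights are absorbed into the state factor: only these products are shown to be bounded, and
   their limits live on the counting measure, whose weights are all 1. *)
pose a r k N := (wx N).1 k * mu r ((wx N).2 k).
pose c E k N := xi E ((wx N).2 k).
have a0 r k N : PS r -> 0 <= a r k N.
  by move=> PSr; rewrite mulr_ge0 ?(wxP N).1 // (nc_mu_ge0 M).
have c0 E k N : PE E -> 0 <= c E k N by exact: (nc_xi_ge0 M).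
have ac_cvg r E : PS r -> PE E ->
    (fun N => \sum_k a r k N * c E k N) @ \oo --> hs r E.
  move=> PSr PEE; rewrite (nc_born M) //.
  under eq_fun do rewrite -(wxP _).2 //.
  exact: Rcvg.
have a_cvg1 r : PS r -> (fun N => \sum_k a r k N) @ \oo --> (1 : R).
  move=> PSr; rewrite -(hs_state_unit PSr).
  have := ac_cvg r _ PSr reduced_unit.
  by under eq_fun do under eq_bigr do rewrite /c model_xi_unit mulr1.
(* A single ultrafilter makes all bounded sequences converge, simultaneously for every state and
   effect, and keeps the limits already known at infinity. *)
have [U [UU ooU]] := @ultraFilterLemma nat \oo _.
have toU (u : nat -> R) (l : R) : u @ \oo --> l -> u @ U --> l.
  by move=> ul A /ul; exact: ooU.
pose mu' r k := lim (a r k @ U); pose xi' E k := lim (c E k @ U).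
have mu'P r k : PS r -> a r k @ U --> mu' r k.
  (* The terms are nonnegative with sum tending to 1, so each is eventually at most 2. *)
  move=> PSr; apply: (@ultra_cvg_bounded _ _ U _ _ 0 2).
  have lt12 : (1 : R) < 2 by rewrite ltr1n.
  apply: ooU; apply: (filterS _ (cvgr_le _ (a_cvg1 r PSr) _ lt12)) => N.
  rewrite a0 //=; apply: le_trans.
  by rewrite (bigD1 k) //= lerDl sumr_ge0 // => j _; exact: a0.
have xi'P E k : PE E -> c E k @ U --> xi' E k.
  move=> PEE; apply: (@ultra_cvg_bounded _ _ U _ _ 0 1).
  by apply: nearW => N; rewrite c0 //= model_xi_le1.
have limE (u : nat -> R) (l l' : R) : u @ U --> l -> u @ U --> l' -> l = l'.
  by move=> /cvg_lim <- // /cvg_lim <-.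
have xi'_affine (p : R) E1 E2 k : 0 <= p <= 1 -> PE E1 -> PE E2 ->
    xi' (p *: E1 + (1 - p) *: E2) k = p * xi' E1 k + (1 - p) * xi' E2 k.
  move=> p01 PE1 PE2; apply: (limE (c (p *: E1 + (1 - p) *: E2) k)).
    exact/xi'P/effects_convex.
  rewrite /c; under eq_fun do rewrite (nc_xi_convex M) //.
  by apply: cvgD; apply: cvgM; (exact: cvg_cst || exact: xi'P).
have xi'0 k : xi' 0 k = 0.
  apply: (limE (c 0 k)); first exact/xi'P/reduced0.
  by rewrite /c; under eq_fun do rewrite model_xi0; exact: cvg_cst.
have xi'1 k : xi' (P (herm1 R n)) k = 1.
  apply: (limE (c (P (herm1 R n)) k)); first exact/xi'P/reduced_unit.
  by rewrite /c; under eq_fun do rewrite model_xi_unit; exact: cvg_cst.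
have PEI E : e E -> PE (P E) by move=> eE; exists E.
exists mu', xi'; split.
- by move=> r _; exact: integrable_counting_ord.
- move=> r PSr; rewrite Rintegral_counting_ord.
  apply: (limE (fun N => \sum_k a r k N)); last exact/toU/a_cvg1.
  by apply: cvg_sumr => k; exact: mu'P.
- move=> r k PSr; apply: (cvgr_to_ge (mu'P r k PSr)).
  by apply: nearW => N; exact: a0.
- move=> p r1 r2 k p01 PS1 PS2.
  apply: (limE (a (p *: r1 + (1 - p) *: r2) k)).
    exact/mu'P/states_convex.
  rewrite /a; under eq_fun do
    rewrite (nc_mu_convex M) // mulrDr mulrCA [X in _ + X]mulrCA.
  by apply: cvgD; apply: cvgM; (exact: cvg_cst || exact: mu'P).
- move=> k m F eF F1; apply: (limE (fun N => \sum_j c (P (F j)) k N)).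
    by apply: cvg_sumr => j; exact/xi'P/PEI.
  rewrite /c; under eq_fun do rewrite (nc_xi_norm_fin M) //.
  exact: cvg_cst.
(* Instead of exchanging the ultralimit with an infinite sum, continuity of the linear extension of
   [xi'] is used. *)
- move=> k F eF Fcvg; rewrite -(xi'1 k).
  exact: (effect_affine_cvg (f := xi'^~ k) (fun p x y => @xi'_affine p x y k)).
- move=> E k PEE; apply: (cvgr_to_ge (xi'P E k PEE)).
  by apply: nearW => N; exact: c0.
- by move=> p E1 E2 k; exact: xi'_affine.
- by move=> r E _ _; exact: integrable_counting_ord.
- move=> r E PSr PEE; rewrite Rintegral_counting_ord.
  (* The same finite sum tends to [hs r E] by Riemann integrability and to the discrete Born sum
     termwise. *)
  apply: (limE (fun N => \sum_k a r k N * c E k N)); first exact/toU/ac_cvg.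
  by apply: cvg_sumr => k; apply: cvgM; [exact: mu'P|exact: xi'P].
Qed.

End Model.
End ScenarioFacts.

Theorem theorem3 (R : realType) (n : nat) (s e : set (herm R n))
    (hse : pm_scenario s e) :
  (forall (d : measure_display) (Lam : measurableType d)
      (nu : {measure set Lam -> \bar R}) (mu xi : herm R n -> Lam -> R),
    nc_model s e nu mu xi ->
    infinite_set [set: Lam] \/
    (finite_set [set: Lam] /\
     (\dim (reduced_space s e) <= #|` fset_set [set: Lam]|)%N)) /\
  ((exists (d : measure_display) (Lam : measurableType d)
      (nu : {measure set Lam -> \bar R}) (mu xi : herm R n -> Lam -> R),
      nc_model s e nu mu xi /\ riemann_integrable s e nu mu xi) ->
   exists (d : measure_display) (Lmin : measurableType d)
      (nu : {measure set Lmin -> \bar R}) (mu xi : herm R n -> Lmin -> R),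
     [/\ discrete_ontic nu, finite_set [set: Lmin], nc_model s e nu mu xi
       & [/\ (\dim (reduced_space s e) <= #|` fset_set [set: Lmin]|)%N,
             (#|` fset_set [set: Lmin]| <= \dim (reduced_space s e) ^ 2)%N
           & (\dim (reduced_space s e) ^ 2 <= \dim {: herm R n} ^ 2)%N]]).
Proof.
split=> [d Lam nu mu xi M|[d [Lam [nu [mu [xi [M Rint]]]]]]].
  have [fin|] := pselect (finite_set [set: Lam]); last by left.
  by right; split=> //; exact: model_dim_le_card M fin.
have D0 := dim_reduced_gt0 hse.
(* The ontic space is given exactly the squared dimension as its number of points; positivity of the
   dimension makes it inhabited and yields the lower bound. *)
have [K KE] : exists K, (\dim (reduced_space s e) ^ 2 = K.+1)%N.
  by exists (\dim (reduced_space s e) ^ 2).-1; rewrite prednK // expn_gt0 D0.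
have [mu' [xi' M']] : exists mu' xi' : herm R n -> 'I_K.+1 -> R,
    nc_model s e (@counting 'I_K.+1 R) mu' xi'.
  by apply: (finite_model hse M) => //; rewrite KE.
exists _, 'I_K.+1, (@counting 'I_K.+1 R), mu', xi'.
split=> //; first exact: finite_finset.
split.
- apply: leq_trans (eq_leq (esym (card_setT_ord K))).
  by rewrite -KE -mulnn leq_pmulr.
- by apply: leq_trans (eq_leq (card_setT_ord K)) _; rewrite KE.
- by rewrite leq_exp2r // dimvS // subvf.
Qed.
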